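(* Let $(R,\mathfrak{m},K)$ be either a Noetherian local ring with maximal ideal $\mathfrak{m}$ and residue field $K$, or a Noetherian standard graded $K$-algebra over a field $K$ with unique graded maximal ideal $\mathfrak{m}$; assume that $K$ is infinite and $\mathrm{depth}\,R>0$. Let $I\subset R$ be a nonzero ideal (homogeneous if $R$ is graded). Then $$\mathfrak{d}_3(I)\ \le\ \mathrm{reg}_{\mathcal{R}(\mathfrak{m})}\,\mathcal{R}(\mathfrak{m},I).$$
   Context: Rings are commutative, Noetherian, unital. $\mathrm{depth}\,R>0$ means that $\mathfrak{m}$ contains a non-zerodivisor of $R$. An ideal $L$ of $R$ is weakly $\mathfrak{m}$-full if $L\mathfrak{m}:\mathfrak{m}=L$. The third Dao number of $I$ is $\mathfrak{d}_3(I)=\min\{t\ge 0 \mid I\mathfrak{m}^k \text{ is weakly } \mathfrak{m}\text{-full for all } k\ge t\}$ (a non-negative integer). $\mathcal{R}(\mathfrak{m})=\bigoplus_{k\ge 0}\mathfrak{m}^k$ is the Rees algebra of $\mathfrak{m}$, a standard graded $R$-algebra with degree-$k$ component $\mathfrak{m}^k$ (so degree-$0$ component $R$), and $\mathcal{R}(\mathfrak{m},I)=\bigoplus_{k\ge0}I\mathfrak{m}^k$ is the homogeneous ideal $I\mathcal{R}(\mathfrak{m})$, viewed as a graded $\mathcal{R}(\mathfrak{m})$-module. Castelnuovo-Mumford regularity: let $S=\bigoplus_{m\ge0}S_m$ be a finitely generated standard graded algebra over a Noetherian ring $S_0$, $S_+=\bigoplus_{m\ge1}S_m$, and $N\ne0$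 a finitely generated graded $S$-module. For $j\ge0$ let $a_j(N)=\max\{n\in\mathbb{Z}\mid H^j_{S_+}(N)_n\neq0\}$, with $a_j(N)=-\infty$ if $H^j_{S_+}(N)=0$, where $H^j_{S_+}$ is local cohomology. Then $\mathrm{reg}_S N=\max\{a_j(N)+j\mid j\ge0\}$. *)

(* Defs.v *)
From HB Require Import structures.
From mathcomp Require Import all_boot all_order all_algebra generic_quotient.
From mathcomp Require Import all_classical constructive_ereal zify.

Set Implicit Arguments.
Unset Strict Implicit.
Unset Printing Implicit Defensive.

Import Order.TTheory GRing.Theory Num.Theory.
Local Open Scope classical_set_scope.
Local Open Scope ring_scope.
Local Open Scope quotient_scope.

Section Ideals.
Variable R : comNzRingType.
Implicit Types (I J L m : set R).

(* The unit ideal is allowed, unlike for MathComp's [idealr_closed]. *)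
Definition ideal J : Prop :=
  J 0 /\ forall a x y, J x -> J y -> J (a * x + y).

Definition ideal_gen (A : set R) : set R := smallest ideal A.

Definition idealM I J : set R := ideal_gen [set x | exists a b, [/\ I a, J b & x = a * b]].

Definition idealX m (k : nat) : set R := iter k (idealM m) [set: R].

Definition colon L J : set R := [set x | forall y, J y -> L (x * y)].

Definition maximal_ideal m : Prop :=
  [/\ ideal m, m <> [set: R] &
      forall J, ideal J -> m `<=` J -> J = m \/ J = [set: R]].

Definition noetherian_ring : Prop :=
  forall J, ideal J -> exists s : seq R, J = ideal_gen [set` s].

Definition subring (A : set R) : Prop :=
  A 1 /\ (forall x y, A x -> A y -> A (x - y) /\ A (x * y)).

Definition weakly_full m L : Prop := colon (idealM L m) m = L.

Definition positive_depth m : Prop := exists2 x, m x & GRing.lreg x.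

(* The infimum is taken in the extended integers; it is a minimum unless no
   [t] qualifies, in which case it is +oo. *)
Definition dao3 m I : \bar int :=
  infimum +oo%E [set (t%:Z)%:E | t in
    [set t : nat | forall k : nat, (t <= k)%N ->
                     weakly_full m (idealM I (idealX m k))]].

Record graded_ring (gr : nat -> set R) : Prop := GradedRing {
  graded0 : forall n, gr n 0;
  gradedB : forall n x y, gr n x -> gr n y -> gr n (x - y);
  graded1 : gr 0%N 1;
  gradedM : forall i j x y, gr i x -> gr j y -> gr (i + j)%N (x * y);
  graded_sum : forall x, exists n (y : nat -> R),
    (forall i, gr i (y i)) /\ x = \sum_(i < n) y i;
  graded_direct : forall n (y : nat -> R), (forall i, gr i (y i)) ->
    \sum_(i < n) y i = 0 -> forall i, (i < n)%N -> y i = 0 }.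

Definition irrelevant (gr : nat -> set R) : set R :=
  [set x | exists n (y : nat -> R),
     (forall i, gr i (y i)) /\ x = \sum_(1 <= i < n) y i].

Definition homogeneous_ideal (gr : nat -> set R) I : Prop :=
  ideal I /\ forall n (y : nat -> R), (forall i, gr i (y i)) ->
    I (\sum_(i < n) y i) -> forall i, (i < n)%N -> I (y i).

Variable K : fieldType.

Definition residue_field m : Prop :=
  exists pi : {rmorphism R -> K}, range pi = setT /\ pi @^-1` [set 0] = m.

Definition local_setting m : Prop :=
  [/\ maximal_ideal m, forall m', maximal_ideal m' -> m' = m & residue_field m].

Definition standard_graded_algebra (iota : K -> R) (gr : nat -> set R) : Prop :=
  [/\ graded_ring gr, gr 0%N = range iota &
      smallest subring (range iota `|` gr 1%N) = setT].

Definition graded_setting m I : Prop :=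
  exists (iota : {rmorphism K -> R}) (gr : nat -> set R),
    [/\ standard_graded_algebra iota gr, m = irrelevant gr &
        homogeneous_ideal gr I].

Lemma ideal_ideal_gen A : ideal (ideal_gen A).
Proof.
split.
  by move=> J [[J0 _] _].
move=> a x y Ax Ay J JA.
by case: (JA) => -[_ +] _; apply; [exact: Ax|exact: Ay].
Qed.

Lemma ideal_idealX m k : ideal (idealX m k).
Proof. by case: k => [|k]; [split|exact: ideal_ideal_gen]. Qed.

Lemma idealMl J a x : ideal J -> J x -> J (a * x).
Proof. by move=> [J0 JD] Jx; rewrite -[_ * _]addr0; apply: JD. Qed.

Lemma idealD J x y : ideal J -> J x -> J y -> J (x + y).
Proof. by move=> [J0 JD] Jx Jy; rewrite -[x]mul1r; apply: JD. Qed.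

Lemma ideal_sum J T (r : seq T) (P : pred T) F :
  ideal J -> (forall i, P i -> J (F i)) -> J (\sum_(i <- r | P i) F i).
Proof.
move=> HJ JF; elim/big_ind: _ => //; first by case: HJ.
by move=> x y; exact: idealD.
Qed.

Lemma idealXD m i j a b :
  idealX m i a -> idealX m j b -> idealX m (i + j) (a * b).
Proof.
move=> + mb; elim: i a => [|i IHi] a.
  by move=> _; apply: idealMl => //; exact: ideal_idealX.
pose J := [set c | idealX m (i.+1 + j) (c * b)].
have HJ := ideal_idealX m (i.+1 + j).
move=> /(_ J); apply; split; first split.
- by rewrite /J /= mul0r; case: HJ.
- by move=> c x y Jx Jy; rewrite /J /= mulrDl -mulrA; apply: HJ.2.
- move=> _ [x [y [mx my ->]]]; rewrite /J /= -mulrA.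
  move=> L [_]; apply; exists x, (y * b); split=> //.
  exact: IHi.
Qed.

Lemma idealMX m I i j a b : idealX m i a ->
  idealM I (idealX m j) b -> idealM I (idealX m (i + j)) (a * b).
Proof.
move=> ma; pose J := [set c | idealM I (idealX m (i + j)) (a * c)].
have HJ : ideal (idealM I (idealX m (i + j))) by exact: ideal_ideal_gen.
move=> /(_ J); apply; split; first split.
- by rewrite /J /= mulr0; case: HJ.
- by move=> c x y Jx Jy; rewrite /J /= mulrDr mulrCA; apply: HJ.2.
- move=> _ [x [y [Ix my ->]]]; rewrite /J /= mulrCA.
  by move=> L [_]; apply; exists x, (a * y); split=> //; exact: idealXD.
Qed.

End Ideals.

(* Localization N_f of a module N: the pair (x, k) stands for x / f ^+ k. *)
Section Localization.
Variables (S : comNzRingType) (N : lmodType S) (f : S).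
Implicit Types p q : N * nat.

Definition loc_eqv p q : bool :=
  `[< exists s, f ^+ s *: (f ^+ q.2 *: p.1) = f ^+ s *: (f ^+ p.2 *: q.1) >].

Lemma loc_eqv_refl : reflexive loc_eqv.
Proof. by move=> p; apply/asboolP; exists 0%N. Qed.

Lemma loc_eqv_sym : symmetric loc_eqv.
Proof. by move=> p q; apply/asboolP/asboolP => -[s /esym]; exists s. Qed.

Lemma loc_eqv_trans : transitive loc_eqv.
Proof.
move=> q p r /asboolP[s Hs] /asboolP[t Ht]; apply/asboolP.
exists (q.2 + s + t)%N; move: Hs Ht; rewrite !scalerA -!exprD => Hs Ht.
rewrite (_ : (q.2 + s + t + r.2 = (t + r.2) + (s + q.2))%N); last by lia.
rewrite exprD -scalerA Hs scalerA -exprD.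
rewrite (_ : (t + r.2 + (s + p.2) = (s + p.2) + (t + r.2))%N); last by lia.
by rewrite exprD -scalerA Ht scalerA -exprD; congr (_ ^+ _ *: _); lia.
Qed.

Canonical loc_equiv := EquivRel loc_eqv loc_eqv_refl loc_eqv_sym loc_eqv_trans.

Definition loc : Type := {eq_quot loc_eqv}.
HB.instance Definition _ := Choice.on loc.
HB.instance Definition _ := EqQuotient.on loc.

Definition frac (x : N) (k : nat) : loc := \pi_loc (x, k).

Lemma frac_eqP x k y l :
  frac x k = frac y l <->
  exists s, f ^+ (s + l) *: x = f ^+ (s + k) *: y.
Proof.
split=> [/eqmodP/asboolP|] [s]; rewrite /= ?scalerA -?exprD => H.
  by exists s.
by apply/eqmodP/asboolP; exists s; rewrite /= !scalerA -!exprD.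
Qed.

Lemma frac_repr (u : loc) : frac (repr u).1 (repr u).2 = u.
Proof. by rewrite /frac -surjective_pairing reprK. Qed.

Lemma frac_reprE x k :
  exists s, f ^+ (s + k) *: (repr (frac x k)).1 =
            f ^+ (s + (repr (frac x k)).2) *: x.
Proof. by have /frac_eqP[s Hs] := frac_repr (frac x k); exists s. Qed.

Lemma frac_expand s x k : frac (f ^+ s *: x) (s + k) = frac x k.
Proof. by apply/frac_eqP; exists 0%N; rewrite scalerA -exprD addnC. Qed.

Definition loc_zero : loc := frac 0 0.
Definition loc_opp (u : loc) : loc := frac (- (repr u).1) (repr u).2.
Definition loc_add (u v : loc) : loc :=
  frac (f ^+ (repr v).2 *: (repr u).1 + f ^+ (repr u).2 *: (repr v).1)
       ((repr u).2 + (repr v).2).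

Lemma loc_oppE x k : loc_opp (frac x k) = frac (- x) k.
Proof.
by have [s Hs] := frac_reprE x k; apply/frac_eqP; exists s; rewrite !scalerN Hs.
Qed.

Lemma loc_addE x k y l :
  loc_add (frac x k) (frac y l) = frac (f ^+ l *: x + f ^+ k *: y) (k + l).
Proof.
rewrite /loc_add; have [s] := frac_reprE x k; have [t] := frac_reprE y l.
case: (repr _) => y' l' /=; case: (repr _) => x' k' /= Hy Hx.
apply/frac_eqP; exists (s + t)%N; rewrite !scalerDr !scalerA -!exprD.
congr (_ + _).
  rewrite (_ : (s + t + (k + l) + l' = (t + l + l') + (s + k))%N); last by lia.
  by rewrite exprD -scalerA Hx scalerA -exprD; congr (_ ^+ _ *: _); lia.
rewrite (_ : (s + t + (k + l) + k' = (s + k + k') + (t + l))%N); last by lia.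
by rewrite exprD -scalerA Hy scalerA -exprD; congr (_ ^+ _ *: _); lia.
Qed.

Lemma loc_addA : associative loc_add.
Proof.
move=> u v w; rewrite -[u]frac_repr -[v]frac_repr -[w]frac_repr !loc_addE.
rewrite addnA; congr frac.
by rewrite !scalerDr !scalerA -!exprD !addrA; congr (_ *: _ + _ *: _ + _);
  congr (_ ^+ _); lia.
Qed.

Lemma loc_addC : commutative loc_add.
Proof.
move=> u v; rewrite -[u]frac_repr -[v]frac_repr !loc_addE addrC.
by rewrite [X in frac _ X]addnC.
Qed.

Lemma loc_add0 : left_id loc_zero loc_add.
Proof.
move=> u; rewrite -[u]frac_repr loc_addE scaler0 add0r.
by rewrite expr0 scale1r add0n.
Qed.

Lemma loc_addN : left_inverse loc_zero loc_opp loc_add.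
Proof.
move=> u; rewrite -[u]frac_repr loc_oppE loc_addE scalerN addNr.
by apply/frac_eqP; exists 0%N; rewrite !scaler0.
Qed.

HB.instance Definition _ :=
  GRing.isZmodule.Build loc loc_addA loc_addC loc_add0 loc_addN.

End Localization.

(* The localization map N_f -> N_g for g = h * f: x / f ^+ k is sent to
   (h ^+ k *: x) / g ^+ k. *)
Definition loc_map (S : comNzRingType) (N : lmodType S) (f g h : S)
    (u : loc N f) : loc N g :=
  frac g (h ^+ (repr u).2 *: (repr u).1) (repr u).2.

Lemma loc_mapE (S : comNzRingType) (N : lmodType S) (f g h : S) (x : N) k :
  g = h * f -> loc_map g h (frac f x k) = frac g (h ^+ k *: x) k.
Proof.
move=> ->; rewrite /loc_map; have [s] := frac_reprE f x k.
case: (repr _) => x' k' /= Hx; apply/frac_eqP; exists s.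
rewrite !scalerA !exprMn.
rewrite (_ : _ * _ * h ^+ k' = h ^+ (s + k + k') * f ^+ (s + k)); last first.
  by rewrite mulrAC -exprD.
by rewrite -scalerA Hx scalerA mulrAC -exprD addnAC.
Qed.

Section LocalCohomology.
Variables (S : comNzRingType) (grS : nat -> set S).
Variables (N : lmodType S) (grN : int -> set N).

Section Cech.
Variable fs : seq S.
Implicit Types s t : {set 'I_(size fs)}.

Definition cech_prod s : S := \prod_(i in s) fs`_i.

(* A cochain of degree j only matters through its values at the s of
   cardinality j. *)
Definition cochain : Type := forall s, loc N (cech_prod s).

Definition cech_d (c : cochain) : cochain := fun t =>
  \sum_(i in t) loc_map (cech_prod t) fs`_i (c (t :\ i))
                *~ (-1) ^+ #|[set l in t | (l < i)%N]|.

(* Degree n part of the localization at cech_prod s, when the fs are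
   homogeneous of degree 1 *)
Definition cech_deg (n : int) s : set (loc N (cech_prod s)) :=
  [set u | exists (k : nat) x,
     grN (n + (k * #|s|)%N%:Z) x /\ u = frac (cech_prod s) x k].

Definition cochain_deg (j : nat) (n : int) (c : cochain) : Prop :=
  forall s, #|s| = j -> cech_deg n (c s).

Definition cocycle (j : nat) (c : cochain) : Prop :=
  forall t, #|t| = j.+1 -> cech_d c t = 0.

(* For j = 0 the sums defining [cech_d b s] are empty, so that the only
   coboundary is 0; the degree condition on b then has no effect. *)
Definition coboundary (j : nat) (n : int) (c : cochain) : Prop :=
  exists2 b : cochain, cochain_deg j.-1 n b &
    forall s, #|s| = j -> c s = cech_d b s.

Definition cech_cohomology_neq0 (j : nat) (n : int) : Prop :=
  exists c : cochain,
    [/\ cochain_deg j n c, cocycle j c & ~ coboundary j n c].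

End Cech.

Definition generates_irrelevant (fs : seq S) : Prop :=
  (forall x, x \in fs -> grS 1%N x) /\ ideal_gen [set` fs] = irrelevant grS.

Definition generators_irrelevant : seq S := xget [::] generates_irrelevant.

(* H^j_{S_+}(N)_n <> 0, local cohomology being the cohomology of the Cech
   complex of N on a finite system of generators of S_+ of degree 1. *)
Definition local_cohomology_neq0 (j : nat) (n : int) : Prop :=
  cech_cohomology_neq0 generators_irrelevant j n.

(* Suprema in the extended integers, that of the empty set being -oo. *)
Definition a_invariant (j : nat) : \bar int :=
  supremum -oo%E [set n%:E%E | n in [set n : int | local_cohomology_neq0 j n]].

Definition regularity : \bar int :=
  supremum -oo%E [set (a_invariant j + (j%:Z)%:E)%E | j in [set: nat]].

End LocalCohomology.

(* The Rees algebra of m, as the subring of the polynomials over R whose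
   coefficient of degree k is in m ^ k. *)
Section Rees.
Variables (R : comNzRingType) (m : set R).

Definition rees_pred : {pred {poly R}} :=
  [pred p : {poly R} | `[< forall k, idealX m k p`_k >]].

Lemma rees_subring_closed : subring_closed rees_pred.
Proof.
split=> [|p q|p q].
- apply/asboolP => k; rewrite coef1; case: k => //= k.
  by case: (ideal_idealX m k.+1).
- move=> /asboolP Hp /asboolP Hq; apply/asboolP => k.
  have H := ideal_idealX m k.
  by rewrite coefB -mulN1r addrC; apply: H.2.
- move=> /asboolP Hp /asboolP Hq; apply/asboolP => k.
  rewrite coefM; apply: ideal_sum; first exact: ideal_idealX.
  move=> i _; rewrite (_ : idealX m k = idealX m (i + (k - i))).
    exact: idealXD.
  by rewrite subnKC // -ltnS.
Qed.

HB.instance Definition _ :=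
  GRing.isSubringClosed.Build {poly R} rees_pred rees_subring_closed.

Record rees := Rees { rees_val :> {poly R}; _ : rees_val \in rees_pred }.

HB.instance Definition _ := [isSub for rees_val].
HB.instance Definition _ := [Choice of rees by <:].
HB.instance Definition _ := [SubChoice_isSubComNzRing of rees by <:].

Definition rees_gr (n : nat) : set rees :=
  [set p | forall k, k <> n -> (rees_val p)`_k = 0].

Variable I : set R.

Definition rees_ideal_pred : {pred rees^o} :=
  [pred p : rees | `[< forall k, idealM I (idealX m k) (rees_val p)`_k >]].

Lemma rees_ideal_submod_closed : submod_closed rees_ideal_pred.
Proof.
split=> [|a p q].
  apply/asboolP => k; rewrite coef0.
  by have [] : ideal (idealM I (idealX m k)) by exact: ideal_ideal_gen.
move=> /asboolP Hp /asboolP Hq; apply/asboolP => k.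
have HI : ideal (idealM I (idealX m k)) by exact: ideal_ideal_gen.
change (idealM I (idealX m k) (rees_val a * rees_val p + rees_val q)`_k).
rewrite coefD; apply: (idealD HI) (Hq k); rewrite coefM.
apply: ideal_sum => // i _; rewrite (_ : idealX m k = idealX m (i + (k - i))).
  by apply: idealMX => //; case: (a) => a' /= /asboolP; exact.
by rewrite subnKC // -ltnS.
Qed.

HB.instance Definition _ := GRing.isSubmodClosed.Build rees rees^o
  rees_ideal_pred rees_ideal_submod_closed.

Record rees_ideal :=
  ReesIdeal { rees_ideal_val :> rees^o; _ : rees_ideal_val \in rees_ideal_pred }.

HB.instance Definition _ := [isSub for rees_ideal_val].
HB.instance Definition _ := [Choice of rees_ideal by <:].
HB.instance Definition _ := [SubChoice_isSubLmodule of rees_ideal by <:].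

Definition rees_ideal_gr (n : int) : set rees_ideal :=
  [set p | forall k : nat, k%:Z <> n ->
           (rees_val (rees_ideal_val p))`_k = 0].

End Rees.

(* Main.v *)
(** Write [t] for the Rees variable, [f_i] for the chosen generators of the
    irrelevant ideal of the Rees algebra, and [N] for the module [R(m, I)].

    If [y m] is contained in [I m^(k+1)], then [y t^k f_i] lies in [N], so the
    fractions [(y t^k f_i) / f_i] form a Cech 1-cocycle of degree [k].  Since
    [m] contains a non-zerodivisor, it is a coboundary only if [y t^k] lies in
    [N].  Hence [I m^k] is weakly [m]-full as soon as [H^1(N)_k = 0], and in
    particular when [k] is at least the regularity.

    The Dao number being non-negative, it remains to see that the regularity is
    non-negative as well.  In the double complex of the Koszul and Cech
    complexes of [N], the class of [u] in [N_0] is connected to the elements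
    [u / f_s] of the diagonal; if [H^p(N)_(-p) = 0] for all [p], descending
    along the diagonal gives [u = 0], because [N_(-1) = 0]. *)

Require Import Defs.
From HB Require Import structures.
From mathcomp Require Import all_boot all_order all_algebra.
From mathcomp Require Import all_classical constructive_ereal zify.

Set Implicit Arguments.
Unset Strict Implicit.
Unset Printing Implicit Defensive.

Import Order.TTheory GRing.Theory Num.Theory.
Local Open Scope classical_set_scope.
Local Open Scope ring_scope.

Local Notation frac := Defs.frac.

(** * Localizations *)

Section LocScale.
Variables (S : comNzRingType) (N : lmodType S).
Implicit Types (f g h a : S) (x y : N).

Lemma fracP f (u : loc N f) : exists x k, u = frac f x k.
Proof. by exists (repr u).1, (repr u).2; rewrite frac_repr. Qed.

Lemma fracN f x k : - frac f x k = frac f (- x) k.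
Proof. exact: loc_oppE. Qed.

Lemma fracD f x y k l :
  frac f x k + frac f y l = frac f (f ^+ l *: x + f ^+ k *: y) (k + l).
Proof. exact: loc_addE. Qed.

Lemma frac0 f k : frac f (0 : N) k = 0.
Proof. by apply/frac_eqP; exists 0%N; rewrite !scaler0. Qed.

Definition locZ f a (u : loc N f) : loc N f :=
  frac f (a *: (repr u).1) (repr u).2.

Lemma locZE f a x k : locZ a (frac f x k) = frac f (a *: x) k.
Proof.
have [s] := frac_reprE f x k; rewrite /locZ; case: (repr _) => x' k' /= H.
by apply/frac_eqP; exists s; rewrite !scalerA -!(mulrC a) -!scalerA H.
Qed.

Lemma locZ_zmod_morphism f a : zmod_morphism (@locZ f a).
Proof.
move=> u v; have [x [k ->]] := fracP u; have [y [l ->]] := fracP v.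
rewrite fracN fracD !locZE fracN fracD.
by rewrite scalerDr !scalerN !scalerA ![a * _]mulrC.
Qed.

HB.instance Definition _ f a :=
  GRing.isZmodMorphism.Build (loc N f) (loc N f) (@locZ f a)
    (locZ_zmod_morphism a).

Lemma locZA f a b (u : loc N f) : locZ a (locZ b u) = locZ (a * b) u.
Proof. by have [x [k ->]] := fracP u; rewrite !locZE scalerA. Qed.

Lemma loc_map_zmod_morphism f g h :
  g = h * f -> zmod_morphism (@loc_map S N f g h).
Proof.
move=> gE u v; have [x [k ->]] := fracP u; have [y [l ->]] := fracP v.
rewrite fracN fracD !(loc_mapE _ _ gE) fracN fracD; congr (frac _ _ _).
rewrite scalerDr !scalerN !scalerA gE !exprMn !exprD.
by rewrite -mulrA [h ^+ k * _]mulrC [h ^+ k * h ^+ l * _]mulrAC.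
Qed.

(** Additivity of [loc_map] depends on the equation [gE], so the structure is built from that proof;
    it gives access to the [raddf] lemmas. *)
Definition loc_map_additive f g h (gE : g = h * f) :
    {additive loc N f -> loc N g} :=
  HB.pack (@loc_map S N f g h)
    (GRing.isZmodMorphism.Build _ _ _ (loc_map_zmod_morphism gE)).

Lemma loc_map_sum f g h (J : Type) (r : seq J) (P : pred J) (F : J -> loc N f) :
  g = h * f -> loc_map g h (\sum_(j <- r | P j) F j) =
               \sum_(j <- r | P j) loc_map g h (F j).
Proof. by move=> gE; exact: (raddf_sum (loc_map_additive gE)). Qed.

Lemma loc_mapMz f g h (u : loc N f) n :
  g = h * f -> loc_map g h (u *~ n) = loc_map g h u *~ n.
Proof. by move=> gE; exact: (raddfMz (loc_map_additive gE)). Qed.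

Lemma loc_map0 f g h : g = h * f -> loc_map g h (0 : loc N f) = 0.
Proof. by move=> gE; exact: (raddf0 (loc_map_additive gE)). Qed.

Lemma loc_mapB f g h (u v : loc N f) :
  g = h * f -> loc_map g h (u - v) = loc_map g h u - loc_map g h v.
Proof. by move=> gE; exact: loc_map_zmod_morphism. Qed.

Lemma loc_map_locZ f g h a (u : loc N f) :
  g = h * f -> loc_map g h (locZ a u) = locZ a (loc_map g h u).
Proof.
move=> gE; have [x [k ->]] := fracP u; rewrite locZE !(loc_mapE _ _ gE) locZE.
by rewrite !scalerA mulrC.
Qed.

End LocScale.

(** * The Koszul-Cech double complex *)

(* The tensor product of the Koszul complex with the Cech complex: an element
   [w] of Koszul degree p is a family of cochains indexed by the sets [T] of
   cardinality p. *)
Section Koszul.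
Variables (S : comNzRingType) (N : lmodType S) (fs : seq S).
Local Notation I := 'I_(size fs).
Local Notation cochain := (cochain N fs).
Implicit Types (s t T : {set I}) (i j : I) (c : cochain)
  (w : {set I} -> cochain).

(** The sign that [cech_d] attaches to omitting [i] from [s]. The Koszul differential reuses it, so
    that the two differentials match on the diagonal. *)
Definition cech_sign i s : int := (-1) ^+ #|[set l in s | (l < i)%N]|.

Lemma cech_sign1 i : cech_sign i [set i]%SET = 1.
Proof.
rewrite /cech_sign (_ : [set l in _ | _] = finset.set0) ?cards0 //.
by apply/finset.setP => l; rewrite !inE; case: eqVneq => // ->; rewrite ltnn.
Qed.

Lemma cech_signU i j s : i != j -> i \notin s ->
  cech_sign j (i |: s) = (-1) ^+ (i < j)%N * cech_sign j s.
Proof.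
move=> ij iNs; rewrite /cech_sign.
have -> : [set l in i |: s | (l < j)%N] =
    ((if (i < j)%N then [set i] else finset.set0)
     :|: [set l in s | (l < j)%N])%SET.
  apply/finset.setP => l; rewrite !inE; case: ifP => lij; rewrite !inE.
    by case: eqVneq => // ->; rewrite lij.
  by case: eqVneq => //= ->; rewrite lij andbF.
case: ifP => // _; last by rewrite finset.set0U mul1r.
by rewrite cardsU1 !inE (negbTE iNs) exprD.
Qed.

(** Inserting the smaller index shifts the position of the larger one but not conversely, so exactly
    one of the two orders picks up an extra sign. *)
Lemma cech_signC i j T : i != j -> i \notin T -> j \notin T ->
  cech_sign i (i |: T) * cech_sign j (j |: (i |: T)) =
  - (cech_sign j (j |: T) * cech_sign i (i |: (j |: T))).
Proof.
move=> ij iT jT; rewrite [j |: (i |: T)]finset.setUCA.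
rewrite [cech_sign j (i |: _)]cech_signU ?inE ?negb_or ?ij //.
rewrite [i |: (j |: T)]finset.setUCA.
rewrite [cech_sign i (j |: _)]cech_signU; first last.
- by rewrite !inE negb_or eq_sym ij.
- by rewrite eq_sym.
case: (ltngtP i j) => [||/val_inj/eqP]; last first.
- by rewrite (negbTE ij).
- by rewrite expr1 expr0 !mul1r mulN1r mulrN opprK mulrC.
- by rewrite expr1 expr0 !mul1r mulN1r mulrN mulrC.
Qed.

Lemma cech_prodD1 i t : i \in t ->
  cech_prod t = fs`_i * cech_prod (t :\ i).
Proof. exact: big_setD1. Qed.

Lemma cech_d_sum (J : finType) (P : pred J) (F : J -> cochain) t :
  cech_d (fun s => \sum_(j | P j) F j s) t = \sum_(j | P j) cech_d (F j) t.
Proof.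
rewrite /cech_d exchange_big; apply: eq_bigr => i it.
by rewrite (loc_map_sum _ _ _ (cech_prodD1 it)) mulrz_suml.
Qed.

Lemma cech_dB c1 c2 t :
  cech_d (fun s => c1 s - c2 s) t = cech_d c1 t - cech_d c2 t.
Proof.
rewrite /cech_d -sumrB; apply: eq_bigr => i it.
by rewrite (loc_mapB _ _ (cech_prodD1 it)) mulrzBl.
Qed.

Lemma cech_dMz c n t : cech_d (fun s => c s *~ n) t = cech_d c t *~ n.
Proof.
rewrite /cech_d mulrz_suml; apply: eq_bigr => i it.
by rewrite (loc_mapMz _ _ (cech_prodD1 it)) mulrzAC.
Qed.

Lemma cech_dZ a c t : cech_d (fun s => locZ a (c s)) t = locZ a (cech_d c t).
Proof.
rewrite /cech_d raddf_sum; apply: eq_bigr => i it.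
by rewrite (loc_map_locZ _ _ (cech_prodD1 it)) raddfMz.
Qed.

(** The homological Koszul differential in coordinates: the basis element of [i |: T] contributes
    f_i times that of [T], up to sign. *)
Definition koszul_d w T : cochain := fun s =>
  \sum_(i | i \notin T) locZ fs`_i (w (i |: T) s) *~ cech_sign i (i |: T).

Lemma koszul_d_cech_d w T t :
  cech_d (koszul_d w T) t = koszul_d (fun T => cech_d (w T)) T t.
Proof.
by rewrite cech_d_sum; apply: eq_bigr => i _; rewrite cech_dMz cech_dZ.
Qed.

Lemma koszul_dd w T s : koszul_d (koszul_d w) T s = 0.
Proof.
pose F i j := locZ (fs`_i * fs`_j) (w (j |: (i |: T)) s) *~
   (cech_sign i (i |: T) * cech_sign j (j |: (i |: T))).
have -> : koszul_d (koszul_d w) T s =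
    \sum_(i | i \notin T) \sum_(j | j \notin i |: T) F i j.
  apply: eq_bigr => i iT; rewrite raddf_sum mulrz_suml; apply: eq_bigr => j _.
  by rewrite raddfMz /= locZA -mulrzA [_ * cech_sign i _]mulrC.
(* Split by the order of [i] and [j]. Once the sums of the second half are exchanged, its terms are
   those of the first with the two indices swapped, and they cancel by [cech_signC]. *)
have -> : \sum_(i | i \notin T) \sum_(j | j \notin i |: T) F i j =
  \sum_(i | i \notin T) \sum_(j | (j \notin T) && (j < i)%N) F i j +
  \sum_(i | i \notin T) \sum_(j | (j \notin T) && (i < j)%N) F i j.
  rewrite -big_split; apply: eq_bigr => i iT /=.
  rewrite (bigID (fun j => (j < i)%N)) /=; congr (_ + _); apply: eq_bigl => j.
    rewrite !inE; case: eqVneq => [->|] //=; first by rewrite ltnn andbF.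
  rewrite !inE -leqNgt leq_eqVlt eq_sym -val_eqE /=.
  by case: eqVneq => //= ->; rewrite ltnn andbF.
rewrite [X in _ + X](exchange_big_dep (fun i => i \notin T)) /=; last first.
  by move=> i j _ /andP[].
rewrite -big_split /=; apply: big1 => i iT; apply/eqP.
rewrite addr_eq0 -sumrN; apply/eqP.
rewrite iT /=; apply: eq_bigr => j /andP[jT ji].
have ij : i != j by rewrite -val_eqE /= gtn_eqF.
by rewrite /F cech_signC // mulrNz finset.setUCA [fs`_j * _]mulrC.
Qed.

Lemma koszul_d_eq w1 w2 T s :
  (forall i, i \notin T -> w1 (i |: T) s = w2 (i |: T) s) ->
  koszul_d w1 T s = koszul_d w2 T s.
Proof. by move=> w12; apply: eq_bigr => i iT; rewrite w12. Qed.

Lemma koszul_dB w1 w2 T s :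
  koszul_d (fun T s => w1 T s - w2 T s) T s =
  koszul_d w1 T s - koszul_d w2 T s.
Proof.
by rewrite /koszul_d -sumrB; apply: eq_bigr => i _; rewrite raddfB mulrzBl.
Qed.

Definition diag_frac (u : N) T : cochain :=
  fun s => if T == s then frac (cech_prod s) u 1 else 0.

(** Both sides vanish unless [t] is [i |: T] for some [i] outside [T]. There the localization map
    rewrites u / f_T as f_i u / f_t, which is f_i times the diagonal entry at [t], and the signs
    agree. *)
Lemma cech_d_diag_frac u T t :
  cech_d (diag_frac u T) t = koszul_d (diag_frac u) T t.
Proof.
rewrite /cech_d /koszul_d big_mkcond [RHS]big_mkcond; apply: eq_bigr => i _.
rewrite /diag_frac; have [it|it] := boolP (i \in t); last first.
  case: ifP => // iT; case: eqP => [iTt|_]; last by rewrite raddf0 mul0rz.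
  by rewrite -iTt setU11 in it.
have prod_t := cech_prodD1 it.
have [iT|iT] := boolP (i \in T) => /=.
  case: eqP => [Tt|_]; first by rewrite Tt setD11 in iT.
  by rewrite (loc_map0 _ prod_t) mul0rz.
have -> : (T == t :\ i) = (i |: T == t).
  apply/eqP/eqP => [->|<-]; first by rewrite finset.setD1K.
  by rewrite finset.setU1K.
case: eqP => [->|_].
  by rewrite (loc_mapE _ _ prod_t) locZE expr1.
by rewrite raddf0 (loc_map0 _ prod_t) !mul0rz.
Qed.

(** * Internal degrees and the descent along the diagonal *)

Variable grN : int -> set N.
Hypothesis grN0 : forall n, grN n 0.
Hypothesis grNB : forall n x y, grN n x -> grN n y -> grN n (x - y).
Hypothesis grNZ : forall n f x, f \in fs -> grN n x -> grN (n + 1) (f *: x).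

Lemma cech_prodZ n s x : grN n x -> grN (n + #|s|%:Z) (cech_prod s *: x).
Proof.
rewrite /cech_prod -big_enum cardE.
elim: (enum s) n => [|i r IHr] n grx /=; first by rewrite big_nil scale1r addr0.
rewrite big_cons -scalerA [(size r).+1%:Z]intS [1 + _]addrC addrA.
by apply: grNZ (IHr _ grx); exact: mem_nth.
Qed.

Lemma cech_prodXZ n s k x :
  grN n x -> grN (n + (k * #|s|)%N%:Z) (cech_prod s ^+ k *: x).
Proof.
elim: k n x => [|k IHk] n x grx; first by rewrite scale1r addr0.
rewrite exprS -scalerA mulSn PoszD [_%:Z + _]addrC addrA.
by apply: cech_prodZ; exact: IHk.
Qed.

Lemma cech_deg0 n s : cech_deg grN n (0 : loc N (cech_prod s)).
Proof. by exists 0%N, 0; split=> //; rewrite frac0. Qed.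

Lemma cech_degB n s (u v : loc N (cech_prod s)) :
  cech_deg grN n u -> cech_deg grN n v -> cech_deg grN n (u - v).
Proof.
move=> [k [x [grx ->]]] [l [y [gry ->]]]; rewrite fracN fracD scalerN.
exists (k + l)%N; eexists; split; last by [].
apply: grNB.
  have := cech_prodXZ s l grx; congr (grN _ _); lia.
have := cech_prodXZ s k gry; congr (grN _ _); lia.
Qed.

Lemma cech_degN n s (u : loc N (cech_prod s)) :
  cech_deg grN n u -> cech_deg grN n (- u).
Proof. by rewrite -[- u]add0r; apply: cech_degB; exact: cech_deg0. Qed.

Lemma cech_degD n s (u v : loc N (cech_prod s)) :
  cech_deg grN n u -> cech_deg grN n v -> cech_deg grN n (u + v).
Proof. by move=> du dv; rewrite -[v]opprK; apply/cech_degB/cech_degN. Qed.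

Lemma cech_degMsign n i T s (u : loc N (cech_prod s)) :
  cech_deg grN n u -> cech_deg grN n (u *~ cech_sign i T).
Proof.
move=> du; rewrite /cech_sign -signr_odd; case: (odd _).
  by rewrite expr1 mulrN1z; exact: cech_degN.
by rewrite expr0 mulr1z.
Qed.

Lemma cech_degZ n i s (u : loc N (cech_prod s)) :
  cech_deg grN n u -> cech_deg grN (n + 1) (locZ fs`_i u).
Proof.
move=> [k [x [grx ->]]]; rewrite locZE; exists k, (fs`_i *: x); split=> //.
by rewrite addrAC; apply: grNZ; first exact: mem_nth.
Qed.

Lemma koszul_d_deg n w T s :
  (forall i, i \notin T -> cech_deg grN n (w (i |: T) s)) ->
  cech_deg grN (n + 1) (koszul_d w T s).
Proof.
move=> dw; apply: big_ind => [|u v|i iT]; [exact: cech_deg0|exact: cech_degD|].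
by apply/cech_degMsign/cech_degZ/dw.
Qed.

Lemma coboundary_of_cocycle p n c : ~ cech_cohomology_neq0 grN fs p n ->
  cochain_deg grN p n c -> cocycle p c -> coboundary grN p n c.
Proof. by move=> H0 dc cc; apply: contrapT => nb; apply: H0; exists c. Qed.

(* Descending induction through the double complex: [diag_frac u] is the
   zigzag that starts at [u / 1], and the vanishing of the cohomology on the
   diagonal lifts it back, one Koszul degree at a time. *)
Lemma koszul_staircase u q :
  (forall p : nat, ~ cech_cohomology_neq0 grN fs p (- p%:Z)) -> grN 0 u ->
  (q <= size fs)%N ->
  exists w, (forall T, #|T| = q.+1 -> cochain_deg grN q (- q.+1%:Z) (w T)) /\
    forall T, #|T| = q ->
      cocycle q (fun s => diag_frac u T s - koszul_d w T s).
Proof.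
move=> H0 gru; elim: (size fs - q)%N {-2}q (erefl (size fs - q)%N) => {q}.
  move=> q sq qs; have {sq qs}-> : q = size fs by lia.
  exists (fun _ _ => 0); split=> [T _ s _|T _ t tq]; first exact: cech_deg0.
  by have := max_card t; rewrite card_ord tq ltnn.
move=> k IHk q kq qs; have [||w [dw cw]] := IHk q.+1; [lia|lia|].
have /choice[b Hb] T : exists b, #|T| = q.+1 ->
    cochain_deg grN q (- q.+1%:Z) b /\
    forall s, #|s| = q.+1 -> diag_frac u T s - koszul_d w T s = cech_d b s.
  have [Tq|] := pselect (#|T| = q.+1); last by exists (fun _ => 0).
  have [|b db Eb] := coboundary_of_cocycle (H0 q.+1) _ (cw _ Tq).
    move=> s sq; apply: cech_degB.
      rewrite /diag_frac; case: eqP => _; last exact: cech_deg0.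
      by exists 1%N, u; split=> //; rewrite sq mul1n addNr.
    (* The correction [w] has internal degree [- q.+2], and the factors f_i in [koszul_d] raise it
       by one. *)
    rewrite (_ : - _ = - q.+2%:Z + 1); last by lia.
    by apply: koszul_d_deg => i iT; apply: dw => //; rewrite cardsU1 iT Tq.
  by exists b.
exists b; split=> [T Tq|T Tq t tq]; first by have [] := Hb _ Tq.
(* On sets of cardinality [q.+1], [cech_d (b T)] is the diagonal minus [koszul_d w]; hence the new
   Cech differential reduces to [koszul_d] applied twice to [w]. *)
rewrite cech_dB cech_d_diag_frac koszul_d_cech_d.
rewrite -(koszul_d_eq (w1 := fun T s => diag_frac u T s - koszul_d w T s)
  (w2 := fun T => cech_d (b T))).
  by rewrite koszul_dB koszul_dd subr0 subrr.
by move=> i iT; have [|_ ->] := Hb (i |: T) => //; rewrite cardsU1 iT Tq.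
Qed.

(** The staircase ends at [q = 0], where the components of [w] have degree -1 and so vanish. Then u
    / 1 is itself a 0-cocycle of degree 0, and the vanishing of H^0 there kills it. *)
Lemma degree0_eq0 :
  (forall p : nat, ~ cech_cohomology_neq0 grN fs p (- p%:Z)) ->
  (forall x, grN (- 1) x -> x = 0) -> forall u, grN 0 u -> u = 0.
Proof.
move=> H0 grN1 u gru; have [//|w [dw cw]] := koszul_staircase (q := 0) H0 gru.
have kw : koszul_d w finset.set0 finset.set0 = 0.
  apply: big1 => i _.
  have [||k [x [grx ->]]] := dw (i |: finset.set0) _ finset.set0.
  - by rewrite cardsU1 inE cards0.
  - by rewrite cards0.
  rewrite cards0 muln0 addr0 in grx.
  by rewrite (grN1 _ grx) locZE scaler0 frac0 mul0rz.
have [|b _ /(_ finset.set0)] :=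
    coboundary_of_cocycle (H0 0) _ (cw _ (cards0 _)).
  move=> s /cards0_eq->; rewrite kw subr0 /diag_frac eqxx.
  by exists 1%N, u; split=> //; rewrite cards0 muln0 addr0.
(* A coboundary in Cech degree 0 is an empty sum, and the localization is at the empty product 1, so
   u / 1 = 0 gives [u = 0]. *)
rewrite cards0 kw subr0 /diag_frac eqxx /cech_d big_set0 => /(_ erefl).
rewrite -(frac0 N _ 0) => /frac_eqP[s].
by rewrite scaler0 /cech_prod big_set0 expr1n scale1r.
Qed.

End Koszul.
(** * The Rees algebra *)

Section IdealFacts.
Variable R : comNzRingType.
Implicit Types (I J m : set R).

Lemma sub_ideal_gen (A : set R) : A `<=` ideal_gen A.
Proof. by move=> x Ax J [_]; apply. Qed.

Lemma ideal_gen_sub (A J : set R) : ideal J -> A `<=` J -> ideal_gen A `<=` J.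
Proof. by move=> HJ AJ x; apply. Qed.

Lemma idealM_gen I J a b : I a -> J b -> idealM I J (a * b).
Proof. by move=> Ia Jb; apply: sub_ideal_gen; exists a, b. Qed.

Lemma idealM_subr I J : ideal J -> idealM I J `<=` J.
Proof.
by move=> HJ; apply: ideal_gen_sub => // _ [a [b [_ Jb ->]]]; exact: idealMl.
Qed.

Lemma sub_idealX1 m : m `<=` idealX m 1.
Proof. by move=> x mx; rewrite -[x]mulr1; exact: idealM_gen. Qed.

(** [idealX m 1] is the product of [m] with the unit ideal rather than literally [m]. The
    multipliers of [y] into [J] form an ideal, so it suffices that they include [m]. *)
Lemma colon_idealX1 J m y : ideal J -> colon J m y -> colon J (idealX m 1) y.
Proof.
move=> HJ my; apply: ideal_gen_sub => [|_ [a [b [ma _ ->]]]]; last first.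
  by rewrite mulrA mulrC; apply: idealMl => //; exact: my.
split=> [|a x z]; first by rewrite mulr0; case: HJ.
by rewrite mulrDr mulrCA => Jx Jz; case: HJ => _; apply.
Qed.

Lemma sub_colon m L : L `<=` colon (idealM L m) m.
Proof. by move=> x Lx y my; exact: idealM_gen. Qed.

Lemma idealM_idealXS m I k :
  idealM (idealM I (idealX m k)) m `<=` idealM I (idealX m k.+1).
Proof.
apply: ideal_gen_sub => [|_ [a [b [La mb ->]]]]; first exact: ideal_ideal_gen.
by rewrite mulrC -[k.+1]add1n; apply: idealMX => //; exact: sub_idealX1.
Qed.

End IdealFacts.

Section ReesFacts.
Variables (R : comNzRingType) (m I : set R).
Local Notation S := (rees m).
Local Notation N := (rees_ideal m I).

Lemma rees_coef (p : S) k : idealX m k (rees_val p)`_k.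
Proof. by have /asboolP := valP p. Qed.

Definition rees_ideal_poly (z : N) : {poly R} := rees_val (rees_ideal_val z).

Lemma rees_ideal_coef (z : N) k : idealM I (idealX m k) (rees_ideal_poly z)`_k.
Proof. by have /asboolP := valP z. Qed.

Lemma rees_ideal_poly_inj : injective rees_ideal_poly.
Proof. by move=> z1 z2 /val_inj/val_inj. Qed.

Lemma rees_ideal_polyZ (g : S) (z : N) :
  rees_ideal_poly (g *: z) = rees_val g * rees_ideal_poly z.
Proof. by []. Qed.

Lemma rees_valX (g : S) n : rees_val (g ^+ n) = rees_val g ^+ n.
Proof. exact: (rmorphXn (val : S -> _)). Qed.

Lemma rees_val_sum (J : Type) (r : seq J) (P : pred J) (F : J -> S) :
  rees_val (\sum_(j <- r | P j) F j) = \sum_(j <- r | P j) rees_val (F j).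
Proof. exact: (raddf_sum (val : S -> _)). Qed.

(** The default value 0 is taken when [a *: 'X^k] is not in the Rees algebra. *)
Definition rees_mon k a : S := insubd (0 : S) (a *: 'X^k).

Lemma rees_monE k a : idealX m k a -> rees_val (rees_mon k a) = a *: 'X^k.
Proof.
move=> ma; apply: insubdK; apply/asboolP => i; rewrite coefZ coefXn.
case: eqP => [->|_]; first by rewrite mulr1.
by rewrite mulr0; case: (ideal_idealX m i).
Qed.

Lemma rees_ideal_mon k (p : {poly R}) :
  (forall i, i != k -> p`_i = 0) -> idealM I (idealX m k) p`_k ->
  exists z : N, rees_ideal_poly z = p.
Proof.
move=> p0 pk; have pI i : idealM I (idealX m i) p`_i.
  have [->//|/p0->] := eqVneq i k.
  by have [] : ideal (idealM I (idealX m i)) by exact: ideal_ideal_gen.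
have pS : p \in rees_pred m.
  apply/asboolP => i; apply: (idealM_subr _ (pI i)); exact: ideal_idealX.
have pN : Rees pS \in rees_ideal_pred I by apply/asboolP.
by exists (ReesIdeal pN).
Qed.

Lemma rees_mon_sum (p : S) :
  p = \sum_(i < size (rees_val p)) rees_mon i (rees_val p)`_i.
Proof.
apply: val_inj; rewrite /= rees_val_sum.
rewrite -[LHS]coefK poly_def; apply: eq_bigr => i _.
by rewrite rees_monE //; exact: rees_coef.
Qed.

Lemma rees_gr_mon k a : idealX m k a -> rees_gr k (rees_mon k a).
Proof.
by move=> ma i /eqP/negbTE ik; rewrite rees_monE // coefZ coefXn ik mulr0.
Qed.

Lemma rees_mon0 k : rees_mon k 0 = 0.
Proof.
apply: val_inj; rewrite /= rees_monE ?scale0r //.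
by case: (ideal_idealX m k).
Qed.

Lemma irrelevant_rees :
  irrelevant (@rees_gr R m) = [set p : S | (rees_val p)`_0 = 0].
Proof.
apply/seteqP; split=> [_ [n [y [gry ->]]]|p p0].
  rewrite /= rees_val_sum coef_sum big_nat big1 // => i /andP[i0 _].
  by rewrite gry //; lia.
exists (size (rees_val p)), (fun i => rees_mon i (rees_val p)`_i); split.
  by move=> i; apply/rees_gr_mon/rees_coef.
rewrite {1}[p]rees_mon_sum.
rewrite -(big_mkord xpredT (fun i => rees_mon i (rees_val p)`_i)).
case: (size _) => [|n]; first by rewrite !big_geq.
by rewrite big_ltn // p0 rees_mon0 add0r.
Qed.

(** Degree 1 suffices because a generator ab of m^(k+2), with a in m and b in m^(k+1), has the
    monomial (a t)(b t^(k+1)). *)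
Lemma rees_generated (s : seq R) : idealX m 1 = ideal_gen [set` s] ->
  generates_irrelevant (@rees_gr R m) [seq rees_mon 1 a | a <- s].
Proof.
move=> ms; have m1 a : a \in s -> idealX m 1 a.
  by rewrite ms => sa; exact: sub_ideal_gen.
split=> [_ /mapP[a sa ->]|]; first exact: rees_gr_mon (m1 _ sa).
set fs := map _ _; set G := ideal_gen _.
have HG : ideal G by exact: ideal_ideal_gen.
rewrite irrelevant_rees; apply/seteqP; split.
  apply: ideal_gen_sub => [|_ /mapP[a sa ->]]; last first.
    by rewrite /= (rees_monE (m1 _ sa)) coefZ coefXn mulr0.
  split=> [|a x y /= x0 y0]; first by rewrite /= coef0.
  by rewrite coefD y0 addr0 coef0M x0 mulr0.
have Gmon k a : idealX m k.+1 a -> G (rees_mon k.+1 a).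
  (* Since [J k] is an ideal, the inclusion of m^(k+1) in it can be tested on generators. *)
  pose J k := [set a | idealX m k.+1 a /\ G (rees_mon k.+1 a)].
  have HJ i : ideal (J i).
    have Hm := ideal_idealX m i.+1.
    split=> [|b x y [mx Gx] [my Gy]].
      by split; [case: Hm|rewrite rees_mon0; case: HG].
    split; first by case: Hm => _; apply.
    rewrite (_ : rees_mon _ _ =
        rees_mon 0 b * rees_mon i.+1 x + rees_mon i.+1 y).
      by case: HG => _; apply.
    apply: val_inj; rewrite /= !rees_monE //; last by case: Hm => _; apply.
    by rewrite expr0 alg_polyC mul_polyC scalerDl scalerA.
  suff : idealX m k.+1 `<=` J k by move=> mJ /mJ[].
  elim: k {a} => [|k IHk].
    rewrite ms; apply: ideal_gen_sub => // a sa; split; first exact: m1.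
    by apply: sub_ideal_gen; exact: map_f.
  apply: ideal_gen_sub => // _ [a [b [ma mb ->]]].
  split; first exact: idealM_gen.
  rewrite (_ : rees_mon _ _ = rees_mon 1 a * rees_mon k.+1 b).
    by apply: (idealMl _ HG); case: (IHk _ mb).
  have m1a := sub_idealX1 ma.
  apply: val_inj; rewrite /= !rees_monE //; last exact: idealM_gen.
  by rewrite -scalerAl -scalerAr scalerA -exprS.
move=> p p0; rewrite [p]rees_mon_sum; apply: ideal_sum => // -[[|i] /= _] _.
  by rewrite p0 rees_mon0; case: HG.
exact: Gmon (rees_coef p i.+1).
Qed.

(** The elements with a power killing [q] form an ideal. It contains the generators, hence also
    [x t] for a non-zerodivisor [x] of [m], and no power of [x t] kills a nonzero polynomial. Here
    [q] may lie outside the Rees algebra. *)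
Lemma rees_torsion_free (fs : seq S) (q : {poly R}) :
  positive_depth m -> ideal_gen [set` fs] = irrelevant (@rees_gr R m) ->
  (forall f, f \in fs -> exists n, rees_val f ^+ n * q = 0) -> q = 0.
Proof.
move=> [x mx regx] fsE q0.
pose J := [set g : S | exists n, rees_val g ^+ n * q = 0].
have HJ : ideal J.
  split=> [|a g h [k gk] [l hl]]; first by exists 1%N; rewrite expr1 mul0r.
  have agk : (rees_val a * rees_val g) ^+ k * q = 0.
    by rewrite exprMn -mulrA gk mulr0.
  exists (k + l)%N; rewrite /= exprDn mulr_suml big1 // => i _.
  rewrite mulrnAl; have [ki|ik] := leqP l i.
    by rewrite -(subnK ki) exprD -!mulrA hl !mulr0 mul0rn.
  have kl : (k <= k + l - i)%N by lia.
  by rewrite -(subnK kl) mulrAC exprD -[_ * _ * q]mulrA agk mulr0 mul0r mul0rn.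
have [] : J (rees_mon 1 x).
  have : irrelevant (@rees_gr R m) (rees_mon 1 x).
    rewrite irrelevant_rees /= rees_monE; last exact: sub_idealX1.
    by rewrite coefZ coefXn mulr0.
  by rewrite -fsE; apply: ideal_gen_sub.
move=> n; rewrite rees_monE; last exact: sub_idealX1.
rewrite exprZn -exprM mul1n -scalerAl => /polyP xq0; apply/polyP => i.
have := xq0 (i + n)%N; rewrite coefZ coefXnM ltnNge leq_addl /= addnK !coef0.
by rewrite -[RHS](mulr0 (x ^+ n)) => /(lregX regx).
Qed.

Lemma rees_cohomology1_neq0 (fs : seq S) k y :
  positive_depth m -> generates_irrelevant (@rees_gr R m) fs ->
  colon (idealM I (idealX m k.+1)) m y -> ~ idealM I (idealX m k) y ->
  cech_cohomology_neq0 (@rees_ideal_gr R m I) fs 1 k.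
Proof.
move=> depth_m [fs1 fsE] my nIy; pose q := y *: 'X^k : {poly R}.
have fq (f : S) : f \in fs -> rees_val f = (rees_val f)`_1 *: 'X.
  move=> /fs1 f1; apply/polyP => i; rewrite coefZ coefX.
  by case: eqP => [->|/f1]; rewrite ?mulr1 // mulr0.
have /choice[z zE] (i : 'I_(size fs)) :
    exists z : N, rees_ideal_poly z = rees_val fs`_i * q.
  have fi : fs`_i \in fs by exact: mem_nth.
  apply: (@rees_ideal_mon k.+1); rewrite (fq _ fi) /q.
    move=> j /negbTE jk.
    by rewrite -scalerAl -scalerAr -exprS !coefZ coefXn jk !mulr0.
  rewrite -scalerAl -scalerAr -exprS !coefZ coefXn eqxx mulr1 mulrC.
  by apply: (colon_idealX1 _ my (rees_coef _ 1)); exact: ideal_ideal_gen.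
have z_gr i : rees_ideal_gr (k%:Z + 1) (z i).
  move=> j jk; rewrite -/(rees_ideal_poly _) zE (fq _ (mem_nth _ _)) // /q.
  rewrite -scalerAl -scalerAr -exprS !coefZ coefXn.
  by case: eqP => [jk1|_]; [case: jk; rewrite jk1; lia|rewrite !mulr0].
(* Only the values at singletons matter; the sum gives z_i / f_i there without choosing an element
   of [s]. *)
pose c : cochain N fs := fun s => \sum_(i in s) frac (cech_prod s) (z i) 1.
exists c; split.
- move=> s /eqP/cards1P[i ->]; rewrite /c big_set1.
  by exists 1%N, (z i); rewrite cards1.
- move=> t /eqP/cards2P[i [j [ij ->]]].
  have jNi : j \notin [set i]%SET by rewrite inE eq_sym.
  have iNj : i \notin [set j]%SET by rewrite inE.
  have ji : j != i by rewrite eq_sym.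
  have tE : [set i; j]%SET = (j |: [set i])%SET by rewrite finset.setUC.
  have cE s l : s = [set l]%SET -> c s = frac (cech_prod s) (z l) 1.
    by move=> ->; rewrite /c big_set1.
  have prodi := @cech_prodD1 S fs i [set i; j]%SET (setU11 _ _).
  have prodj := @cech_prodD1 S fs j [set i; j]%SET (setU1r _ (set11 _)).
  rewrite /cech_d big_setU1 //= big_set1.
  rewrite (cE _ _ (finset.setU1K iNj)) (cE _ i); last first.
    by rewrite tE finset.setU1K.
  rewrite (loc_mapE _ _ prodi) (loc_mapE _ _ prodj) !expr1.
  (* Both numerators are f_i f_j q, and the two signs are opposite. *)
  rewrite (_ : fs`_j *: z i = fs`_i *: z j); last first.
    by apply: rees_ideal_poly_inj; rewrite !rees_ideal_polyZ !zE mulrCA.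
  rewrite -mulrzDr -/(cech_sign i _) -/(cech_sign j _).
  suff -> : cech_sign i [set i; j]%SET + cech_sign j [set i; j]%SET = 0 by [].
  rewrite [cech_sign j _]cech_signU // tE cech_signU // !cech_sign1 !mulr1.
  by case: (ltngtP i j) ij => [||/val_inj ->]; rewrite ?eqxx.
move=> [b db bE]; apply: nIy.
have [l [x [grx bx]]] := db _ (cards0 _).
(* At the empty set [b] is the fraction of some [x] in [N] over a power of 1; if [q] is [x], its
   coefficient of degree [k] puts [y] in I m^k. *)
suff qx : q = rees_ideal_poly x.
  have := @rees_ideal_coef x k; rewrite -qx /q coefZ coefXn eqxx mulr1.
  exact.
apply/eqP; rewrite -subr_eq0; apply/eqP.
apply: (rees_torsion_free depth_m fsE) => f /(nthP 0)[i0 i0s <-].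
pose i := Ordinal i0s; have := bE [set i]%SET (cards1 _).
rewrite /c /cech_d !big_set1.
have prodi := @cech_prodD1 S fs i [set i]%SET (set11 _).
have bs s : s = finset.set0 -> b s = frac (cech_prod s) x l by move=> ->.
rewrite (bs _ (finset.setDv _)).
rewrite (loc_mapE _ _ prodi) -/(cech_sign i _) cech_sign1 mulr1z.
move=> /frac_eqP[s] /(congr1 rees_ideal_poly).
rewrite !rees_ideal_polyZ !rees_valX zE /cech_prod big_set1 => fqx.
(* The equality of fractions reads f_i^(s+l) (f_i q) = f_i^(s+1) (f_i^l x), whence the exponent. *)
exists (s + l).+1; rewrite mulrBr exprSr -mulrA fqx.
by rewrite mulrA -exprD addnAC addn1 -exprSr subrr.
Qed.

End ReesFacts.

(** * Regularity *)

Section ExtendedIntegers.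
Local Open Scope ereal_scope.
Implicit Type A : set (\bar int).

(** This makes [supremum] a genuine least upper bound rather than its default value. In the only
    case not settled by an infinite value, the set has a largest integer. *)
Lemma ereal_int_supremums A : supremums A !=set0.
Proof.
have [Apoo|Anpoo] := pselect (A +oo).
  by exists +oo; split=> [x _|x]; [exact: leey|exact].
have [[n0 An0]|Anfin] := pselect (exists n : int, A n%:E); last first.
  exists -oo; split=> [x Ax|x _]; last exact: leNye.
  by case: x Ax => // n An; case: Anfin; exists n.
have [[M AM]|Aunb] := pselect (exists M : int, ubound A M%:E); last first.
  exists +oo; split=> [x _|x Ax]; first exact: leey.
  by case: x Ax => [M AM|//|/(_ _ An0)//]; case: Aunb; exists M.
(* The distances [M - n], for [n] in [A], have a least element. *)
pose P := fun d : nat => `[< A (M - d%:Z)%:E >].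
have exP : exists d, P d.
  have n0M : (n0 <= M)%R by have := AM _ An0; rewrite lee_fin.
  exists `|M - n0|%N; apply/asboolP.
  by rewrite gez0_abs ?subr_ge0 // opprB addrC subrK.
case: (ex_minnP exP) => d /asboolP Ad dmin.
exists (M - d%:Z)%:E; split=> [x Ax|x]; last exact.
case: x Ax => [n An|//|_]; last exact: leNye.
have nM : (n <= M)%R by have := AM _ An; rewrite lee_fin.
have /dmin : P `|M - n|%N.
  by apply/asboolP; rewrite gez0_abs ?subr_ge0 // opprB addrC subrK.
by rewrite lee_fin; lia.
Qed.

Lemma ereal_int_infimums A : infimums A !=set0.
Proof.
have [s [ub lub]] := ereal_int_supremums (lbound A).
by exists s; split=> // x Ax; apply: lub => y; apply.
Qed.

Lemma le_supremum_ereal_int x0 A x : A x -> x <= supremum x0 A.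
Proof. exact/ge_supremum_Nmem/ereal_int_supremums. Qed.

Lemma ge_infimum_ereal_int x0 A x : A x -> infimum x0 A <= x.
Proof. exact/le_infimum_Nmem/ereal_int_infimums. Qed.

End ExtendedIntegers.

Lemma local_cohomology_le_regularity (S : comNzRingType) (grS : nat -> set S)
    (N : lmodType S) (grN : int -> set N) j n :
  local_cohomology_neq0 grS grN j n -> ((n + j%:Z)%:E <= regularity grS grN)%E.
Proof.
move=> Hjn; apply: (@le_trans _ _ (a_invariant grS grN j + (j%:Z)%:E)%E).
  by rewrite EFinD; apply: leeD2r; apply: le_supremum_ereal_int; exists n.
by apply: le_supremum_ereal_int; exists j.
Qed.

(** Finite generation of [idealX m 1] rules out the default [[::]] of [xget] for want of a
    generating system. *)
Lemma generators_irrelevantP (R : comNzRingType) (m : set R) :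
  noetherian_ring R ->
  generates_irrelevant (@rees_gr R m) (generators_irrelevant (@rees_gr R m)).
Proof.
move=> noeth; have [s ms] := noeth _ (ideal_idealX m 1).
apply: xgetPex; exists [seq rees_mon m 1 a | a <- s]; exact: rees_generated.
Qed.

Lemma regularity_rees_ge0 (R : comNzRingType) (m I : set R) :
  noetherian_ring R -> ideal I -> I <> [set 0] ->
  (0 <= regularity (@rees_gr R m) (@rees_ideal_gr R m I))%E.
Proof.
move=> noeth HI In0; have [fs1 _] := generators_irrelevantP m noeth.
set fs := generators_irrelevant _ in fs1.
(* A nonzero H^p in degree -p contributes -p + p = 0 to the regularity. Otherwise [degree0_eq0]
   kills every element of [I], seen as a constant polynomial in degree 0 of the module. *)
have [[p Hp]|H0] := pselect (exists p : nat,
    cech_cohomology_neq0 (@rees_ideal_gr R m I) fs p (- p%:Z)).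
  by have := local_cohomology_le_regularity Hp; rewrite addNr.
case: In0; apply/seteqP; split=> [a Ia|_ ->]; last by case: HI.
have [||z zE] := @rees_ideal_mon R m I 0 a%:P.
- by move=> i i0; rewrite coefC (negbTE i0).
- by rewrite coefC -[a]mulr1; exact: idealM_gen.
suff z0 : z = 0.
  by have := congr1 (fun p : {poly R} => p`_0) zE; rewrite z0 coefC coef0.
apply: (@degree0_eq0 _ _ fs (@rees_ideal_gr R m I)); last first.
- by move=> i; rewrite -/(rees_ideal_poly z) zE coefC; case: eqP => // ->.
- move=> x grx; apply: rees_ideal_poly_inj; apply/polyP => i.
  by rewrite coef0; apply: grx.
- by move=> p Hp; apply: H0; exists p.
- move=> n f x fs_f grx i ik; rewrite -/(rees_ideal_poly _) rees_ideal_polyZ.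
  rewrite coefM big1 // => j _; have [j1|/eqP j1] := eqVneq (j : nat) 1%N.
    rewrite [X in _ * X]grx ?mulr0 // => ijn; apply: ik; have := ltn_ord j.
    by rewrite -ijn j1; lia.
  by rewrite (fs1 _ fs_f) // mul0r.
- by move=> n x y grx gry i ik; rewrite coefB grx // gry // subr0.
- by move=> n i _; rewrite coef0.
Qed.

(** A failure at [k] would make H^1 nonzero in degree [k], forcing k + 1 <= reg <= k. *)
Lemma weakly_full_idealM_idealX (R : comNzRingType) (m I : set R) k :
  noetherian_ring R -> positive_depth m ->
  (regularity (@rees_gr R m) (@rees_ideal_gr R m I) <= k%:Z%:E)%E ->
  weakly_full m (idealM I (idealX m k)).
Proof.
move=> noeth depth_m reg_k; apply/seteqP; split; last exact: sub_colon.
move=> y Ly; apply: contrapT => nLy.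
have my : colon (idealM I (idealX m k.+1)) m y.
  by move=> a ma; apply: idealM_idealXS; exact: Ly.
have := rees_cohomology1_neq0 depth_m (generators_irrelevantP m noeth) my nLy.
move=> /local_cohomology_le_regularity/le_trans/(_ reg_k).
by rewrite lee_fin; lia.
Qed.

Theorem theorem3p4 (K : fieldType) (R : comNzRingType) (m I : set R) :
  noetherian_ring R ->
  local_setting K m \/ graded_setting K m I ->
  infinite_set [set: K] ->
  positive_depth m ->
  ideal I -> I <> [set 0] ->
  (dao3 m I <= regularity (@rees_gr R m) (@rees_ideal_gr R m I))%E.
Proof.
move=> noeth _ _ depth_m HI In0.
have := regularity_rees_ge0 m noeth HI In0.
(* Non-negativity leaves a natural number [t], which belongs to the set whose infimum is [dao3], or
   the trivial bound +oo. *)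
case regE : (regularity _ _) => [[t|t]| |] // _; last exact: leey.
apply: ge_infimum_ereal_int; exists t => // k tk.
by apply: weakly_full_idealM_idealX; rewrite // regE lee_fin lez_nat.
Qed.
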